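(* Let $D = (D_{ij})$ be an $m \times m$ matrix of differences and let $F = (f_{ij})$ be a non-degenerate self-conjugate $m \times m$ matrix of Laurent polynomials majorized by $D$. Then \[ \alpha(D) \leq \min(\rho_+(F), \rho_-(F)). \]
   Context: An $m\times m$ matrix of differences is a matrix $D = (D_{ij})$ of finite subsets of $\mathbb{Z}$ with $D_{ji} = -D_{ij}$ for all $i,j$. The $m$-block circulant graph $G_n$ with matrix of differences $D$ has vertex set $\{(i,u) : 0 \leq i \leq m-1,\ 0 \leq u \leq n-1\}$, and $(i,u)$, $(j,v)$ (possibly equal) are adjacent iff $v - u$ is congruent modulo $n$ to some element of $D_{ij}$. $\alpha(G)$ is the maximum size of an independent set (no two adjacent vertices, no looped vertex), and $\alpha(D) := \lim_{n\to\infty} \alpha(G_n)/(nm)$ (this limit exists). For a Laurent polynomial $g(z) = \sum_k c_k z^k$ its conjugate is $\overline{g}(z) = \sum_k \overline{c_k} z^{-k}$. A matrix $F = (f_{ij})$ of Laurent polynomials in $z$ is self-conjugate if $f_{ji} = \overline{f_{ij}}$ for all $i,j$ (so $F(z)$ is Hermitian for $|z|=1$); it is non-degenerate if $\det F$ is a non-zero Laurent polynomial; it is majorized by $D$ if each $f_{ij}$ has the form $\sum_{d \in D_{ij}} c_d z^d$. Define $\rho_+(F) = \frac{1}{2\pi m}\int_0^{2\pi} N_+(\theta)\, d\theta$ and $\rho_-(F) = \frac{1}{2\pi m}\int_0^{2\pi} N_-(\theta)\, d\theta$, where $N_+(\theta)$ (resp. $N_-(\theta)$) is the number of positive (resp.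 negative) eigenvalues of the Hermitian matrix $F(e^{i\theta})$ counted with multiplicity. *)

(* Defs.v *)
From HB Require Import structures.
From mathcomp Require Import all_boot all_order all_algebra.
From mathcomp Require Import all_classical all_reals all_analysis.
From mathcomp Require Import complex.
Set Implicit Arguments. Unset Strict Implicit. Unset Printing Implicit Defensive.
Import Order.TTheory GRing.Theory Num.Theory.
Import numFieldNormedType.Exports.
Local Open Scope ring_scope.

(** An m x m matrix of differences: finite subsets D i j of Z (given as
    finite sequences; only membership matters), with D j i = - D i j. *)
Definition is_diff_matrix (m : nat) (D : 'I_m -> 'I_m -> seq int) : Prop :=
  forall i j d, (d \in D j i) = (- d \in D i j).

Definition circ_adj (m : nat) (D : 'I_m -> 'I_m -> seq int) (n : nat)
    (x y : 'I_m * 'I_n) : bool :=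
  has (fun d : int => ((y.2 : nat)%:Z - (x.2 : nat)%:Z == d %[mod n%:Z])%Z) (D x.1 y.1).

(** Independent set: no two (possibly equal) vertices of S adjacent
    (so in particular no looped vertex lies in S). *)
Definition circ_indep (m : nat) (D : 'I_m -> 'I_m -> seq int) (n : nat)
    (S : {set 'I_m * 'I_n}) : bool :=
  [forall x in S, forall y in S, ~~ circ_adj D x y].

Definition alpha_G (m : nat) (D : 'I_m -> 'I_m -> seq int) (n : nat) : nat :=
  \max_(S : {set 'I_m * 'I_n} | circ_indep D S) #|S|.

Definition alpha_D (R : realType) (m : nat) (D : 'I_m -> 'I_m -> seq int) : R :=
  limn (fun n : nat => (alpha_G D n)%:R / (n * m)%:R : R).

(** A matrix F of Laurent polynomials majorized by D is given by its
    coefficients c i j d (coefficient of z^d in f_ij), supported in D i j. *)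
Definition majorized (R : realType) (m : nat) (D : 'I_m -> 'I_m -> seq int)
    (c : 'I_m -> 'I_m -> int -> R[i]) : Prop :=
  forall i j d, c i j d != 0 -> d \in D i j.

(** Self-conjugate: f_ji = conj(f_ij), i.e. coefficientwise
    c j i d = conj (c i j (-d)). *)
Definition self_conjugate (R : realType) (m : nat)
    (c : 'I_m -> 'I_m -> int -> R[i]) : Prop :=
  forall i j d, c j i d = conjc (c i j (- d)).

Definition laurent_eval (R : realType) (m : nat) (D : 'I_m -> 'I_m -> seq int)
    (c : 'I_m -> 'I_m -> int -> R[i]) (z : R[i]) : 'M[R[i]]_m :=
  \matrix_(i, j) \sum_(d <- undup (D i j)) c i j d * exprz z d.

(** A shift N with |d| <= N for all d occurring in D. *)
Definition shiftN (m : nat) (D : 'I_m -> 'I_m -> seq int) : nat :=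
  \sum_i \sum_j \sum_(d <- D i j) absz d.

(** z^N F(z) as a matrix of genuine polynomials; det F = z^(-N m) det(z^N F),
    so det F is a nonzero Laurent polynomial iff this determinant is a
    nonzero polynomial. *)
Definition shifted_poly_mx (R : realType) (m : nat) (D : 'I_m -> 'I_m -> seq int)
    (c : 'I_m -> 'I_m -> int -> R[i]) : 'M[{poly R[i]}]_m :=
  \matrix_(i, j) \sum_(d <- undup (D i j))
      c i j d *: 'X^(absz (d + (shiftN D)%:Z)).

Definition non_degenerate (R : realType) (m : nat) (D : 'I_m -> 'I_m -> seq int)
    (c : 'I_m -> 'I_m -> int -> R[i]) : Prop :=
  \det (shifted_poly_mx D c) != 0.

(** Eigenvalues (with multiplicity) of a complex square matrix: the roots of
    its characteristic polynomial, which splits over the closed field R[i]. *)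
Definition eigenvalues (R : realType) (m : nat) (A : 'M[R[i]]_m) : seq R[i] :=
  sval (closed_field_poly_normal (char_poly A)).

Definition n_pos (R : realType) (m : nat) (A : 'M[R[i]]_m) : nat :=
  count (fun x => 0 < x) (eigenvalues A).
Definition n_neg (R : realType) (m : nat) (A : 'M[R[i]]_m) : nat :=
  count (fun x => x < 0) (eigenvalues A).

Definition expi (R : realType) (t : R) : R[i] := Complex (cos t) (sin t).

Local Open Scope ereal_scope.
Definition rho_plus (R : realType) (m : nat) (D : 'I_m -> 'I_m -> seq int)
    (c : 'I_m -> 'I_m -> int -> R[i]) : \bar R :=
  ((2 * pi * m%:R)^-1)%R%:E *
  \int[@lebesgue_measure R]_(t in `[0%R, (2 * pi)%R])
     ((n_pos (laurent_eval D c (expi t)))%:R)%:E.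
Definition rho_minus (R : realType) (m : nat) (D : 'I_m -> 'I_m -> seq int)
    (c : 'I_m -> 'I_m -> int -> R[i]) : \bar R :=
  ((2 * pi * m%:R)^-1)%R%:E *
  \int[@lebesgue_measure R]_(t in `[0%R, (2 * pi)%R])
     ((n_neg (laurent_eval D c (expi t)))%:R)%:E.

(* Main.v *)
Require Import Defs.
From HB Require Import structures.
From mathcomp Require Import all_boot all_order all_algebra.
From mathcomp Require Import all_classical all_reals all_analysis.
From mathcomp Require Import measurable_realfun complex.
From mathcomp Require Import zify ring lra.
Import Order.TTheory GRing.Theory Num.Theory.
Import numFieldNormedType.Exports.
Local Open Scope ring_scope.
Set Implicit Arguments. Unset Strict Implicit. Unset Printing Implicit Defensive.

(** The block circulant matrix of [G_n] with weights [c] vanishes on an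
    independent set [S], so its negative eigenspace meets the coordinate space
    of [S] trivially.  The discrete Fourier transform splits this matrix into
    the blocks [F(w^k)], with [w] a primitive [n]-th root of unity, whence
    [#|S| + \sum_k N_-(2 pi k / n) <= n m].  As [N_-] is lower semicontinuous,
    Fatou's lemma applied to its step functions bounds [alpha(D)] by
    [1 - rho_-(F)].  This equals [rho_+(F)] because [det F(e^(i t)) <> 0] except
    at finitely many [t]; the other bound is this one for [- F].  That the
    densities of [G_n] converge at all comes from repeating independent sets
    periodically. *)

(** * Inertia of Hermitian matrices *)

(** By rank, a homogeneous system with fewer equations than unknowns has a nonzero solution; [P]
    selects the unknowns and [Q] the equations. Two dimension counts below rest on it. *)
Lemma kernel_vector (F : fieldType) (I J : finType) (P : pred I) (Q : pred J)
    (M : I -> J -> F) : (#|Q| < #|P|)%N ->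
  exists y : I -> F, [/\ exists i, y i != 0, forall i, ~~ P i -> y i = 0
    & forall j, Q j -> \sum_i y i * M i j = 0].
Proof.
move=> ltQP.
pose B := (\matrix_(i < #|P|, j < #|Q|) M (enum_val i) (enum_val j))%R.
have kerB0 : kermx B != 0.
  rewrite kermx_eq0 /row_free neq_ltn.
  by rewrite (leq_ltn_trans (rank_leq_col B)).
have /rowV0Pn[v /sub_kermxP vB v0] := kerB0.
pose y i := \sum_k v 0 k * (enum_val k == i)%:R.
have yE k : y (enum_val k) = v 0 k.
  rewrite /y (bigD1 k) //= eqxx mulr1 big1 ?addr0 // => l /negPf lk.
  by rewrite (inj_eq enum_val_inj) lk mulr0.
exists y; split.
- have /existsP[k vk] : [exists k, v 0 k != 0].
    apply: contraNT v0 => /existsPn vz; apply/eqP/rowP => k.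
    by rewrite mxE; apply/eqP; have := vz k; rewrite negbK.
  by exists (enum_val k); rewrite yE.
- move=> i Pi; rewrite /y big1 // => k _.
  have [ki|] := eqVneq; last by rewrite mulr0.
  by move: Pi; rewrite -ki -[P _]/(_ \in P) enum_valP.
- move=> j Qj; have jQ : j \in Q by [].
  have /rowP/(_ (enum_rank_in jQ j)) := vB; rewrite !mxE => vBj.
  rewrite -[RHS]vBj.
    transitivity (\sum_i \sum_k v 0 k * (enum_val k == i)%:R * M i j).
    by apply: eq_bigr => i _; rewrite /y mulr_suml.
  rewrite exchange_big /=; apply: eq_bigr => k _.
  rewrite (bigD1 (enum_val k)) //= eqxx mulr1 big1 ?addr0.
    by rewrite mxE enum_rankK_in.
  by move=> i /negPf; rewrite eq_sym => ->; rewrite mulr0 mul0r.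
Qed.

(** If the bound failed, some nonzero combination [x] of the eigenvectors in [P] would vanish off
    [S]. The form of [A] at [x] would then be zero, since [A] vanishes on [S], yet negative, as a
    sum of negative eigenvalues times squared moduli. The common squared norm [a] admits
    unnormalised Fourier vectors. *)
Lemma inertia_bound (C : numClosedFieldType) (I J : finType) (P : pred I)
    (S : {set J}) (A : J -> J -> C) (X : I -> J -> C) (l : I -> C) (a : C) :
  0 < a ->
  (forall i j, \sum_k A j k * X i k = l i * X i j) ->
  (forall i i', \sum_j (X i j)^* * X i' j = a * (i == i')%:R) ->
  (forall i, P i -> l i < 0) ->
  {in S &, forall j k, A j k = 0} -> (#|P| + #|S| <= #|J|)%N.
Proof.
move=> a0 AX XX l0 AS; rewrite leqNgt; apply/negP => ltJ.
have ltP : (#|~: S| < #|P|)%N.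
  by move: ltJ; rewrite -(cardsC S) addnC ltn_add2r.
have [y [[i0 yi0] yP yS]] := kernel_vector (Q := mem (~: S)) X ltP.
pose x j := \sum_i y i * X i j.
have x0 j : j \notin S -> x j = 0 by move=> jS; apply: yS; rewrite /= inE.
have Q0 : \sum_j (x j)^* * \sum_k A j k * x k = 0.
  apply: big1 => j _; have [jS|/x0 ->] := boolP (j \in S); last first.
    by rewrite conjC0 mul0r.
  rewrite big1 ?mulr0 // => k _; have [kS|/x0 ->] := boolP (k \in S).
    by rewrite AS // mul0r.
  by rewrite mulr0.
have Ax j : \sum_k A j k * x k = \sum_i l i * y i * X i j.
  under eq_bigr do rewrite mulr_sumr.
  rewrite exchange_big; apply: eq_bigr => i _ /=.
  rewrite -mulrA mulrCA -AX mulr_sumr.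
  by apply: eq_bigr => k _; rewrite mulrCA.
have QE : \sum_j (x j)^* * \sum_k A j k * x k
    = \sum_i a * (l i * `|y i| ^+ 2).
  under eq_bigr do rewrite Ax rmorph_sum mulr_suml.
  rewrite exchange_big; apply: eq_bigr => i _ /=.
  under eq_bigr do rewrite mulr_sumr.
  rewrite exchange_big (bigD1 i) //= [X in _ + X]big1 => [|i' i'i].
    under eq_bigr do rewrite rmorphM mulrACA.
    rewrite -mulr_sumr XX eqxx normCK mulr1 /=; ring.
  under eq_bigr do rewrite rmorphM mulrACA.
  by rewrite -mulr_sumr XX eq_sym (negPf i'i) !mulr0.
suff : \sum_j (x j)^* * \sum_k A j k * x k < 0 by rewrite Q0 ltxx.
have term i : P i -> l i * `|y i| ^+ 2 <= 0.
  by move=> /l0 li; rewrite nmulr_rle0 // exprn_ge0.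
have Pi0 : P i0 by apply: contraNT yi0 => /yP ->.
rewrite QE -mulr_sumr pmulr_rlt0 // (bigD1 i0) //=.
rewrite ltr_nwDl //.
  by rewrite nmulr_rlt0 ?l0 // exprn_gt0 ?normr_gt0.
apply: sumr_le0 => i _; have [/term//|/yP ->] := boolP (P i).
by rewrite normr0 expr0n mulr0.
Qed.

Lemma char_poly_simil (K : fieldType) n (P A B : 'M[K]_n) :
  P \in unitmx -> P *m A = B *m P -> char_poly A = char_poly B.
Proof.
move=> Pu PA; pose Q := map_mx polyC P.
have Qu : \det Q != 0.
  by rewrite det_map_mx polyC_eq0 -unitfE -unitmxE.
apply: (mulfI Qu); rewrite [RHS]mulrC -!det_mulmx; congr (\det _).
by rewrite mulmxBr mulmxBl -scalar_mxC -!map_mxM PA.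
Qed.

(** [X a] is the unit eigenvector for [d a]. The last clause, a resolution of the identity, is dual
    to orthonormality and serves to expand [A] spectrally. *)
Definition eigenbasis (R : realType) m (A : 'M[R[i]]_m)
    (X : 'I_m -> 'I_m -> R[i]) (d : 'I_m -> R[i]) :=
  [/\ forall a, d a \is Num.real,
      forall a i, \sum_j A i j * X a j = d a * X a i,
      forall a b, \sum_i (X a i)^* * X b i = (a == b)%:R
    & forall i j, \sum_a (X a i)^* * X a j = (i == j)%:R].

(** The spectral theorem: the eigenvectors are the conjugated rows of the unitary [spectralmx A],
    that is, the columns of its inverse. *)
Lemma hermitian_eigenbasis (R : realType) m (A : 'M[R[i]]_m) :
  (forall i j, A j i = (A i j)^*) -> exists X d, eigenbasis A X d.
Proof.
move=> Aherm.
have hA : A \is hermsymmx.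
  apply/is_hermitianmxP; rewrite expr0 scale1r.
  by apply/matrixP => i j; rewrite !mxE Aherm.
have /orthomx_spectralP AE := hermitian_normalmx hA.
have Dr := hermitian_spectral_diag_real hA.
have Pun := spectral_unitarymx A.
have Pu := spectral_unit A.
move: AE Dr Pun Pu; set P := spectralmx A; set D := spectral_diag A.
move=> AE Dr Pun Pu.
have PV : invmx P = (P^t*)%sesqui by exact: invmx_unitary.
have AP : A *m invmx P = invmx P *m diag_mx D by rewrite {1}AE mulmxK.
exists (fun a i => (P a i)^*), (fun a => D 0 a); split.
- by move=> a; have /mxOverP := Dr; exact.
- move=> a i; have /matrixP/(_ i a) := AP; rewrite PV !mxE.
  under eq_bigr do rewrite !mxE.
  move=> ->; rewrite (bigD1 a) //= big1 => [|b /negPf ba].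
    by rewrite !mxE eqxx mulr1n addr0 mulrC.
  by rewrite !mxE ba mulr0n mulr0.
- move=> a b; have /matrixP/(_ a b) : P *m invmx P = 1%:M by rewrite mulmxV.
  rewrite PV !mxE => <-; apply: eq_bigr => i _.
  by rewrite !mxE conjCK.
- move=> i j; have /matrixP/(_ j i) : invmx P *m P = 1%:M by rewrite mulVmx.
  rewrite PV !mxE eq_sym => <-; apply: eq_bigr => a _.
  by rewrite !mxE conjCK mulrC.
Qed.

Lemma char_poly_eigenvalues (R : realType) m (A : 'M[R[i]]_m) :
  char_poly A = \prod_(z <- eigenvalues A) ('X - z%:P).
Proof.
rewrite /eigenvalues; case: closed_field_poly_normal => s /= {1}->.
by rewrite (monicP (char_poly_monic A)) scale1r.
Qed.

(** The matrix with columns [X a] conjugates [A] to a diagonal matrix with the same characteristic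
    polynomial, whose linear factors are unique. This ties the chosen list [eigenvalues A] to any
    eigenbasis. *)
Lemma eigenbasis_eigenvalues (R : realType) m (A : 'M[R[i]]_m) X d :
  eigenbasis A X d -> perm_eq (eigenvalues A) [seq d a | a <- enum 'I_m].
Proof.
move=> [_ AX XX _]; pose P : 'M[R[i]]_m := \matrix_(i, a) X a i.
pose D : 'M[R[i]]_m := diag_mx (\row_a d a).
have PA : P *m D = A *m P.
  apply/matrixP => i a; rewrite !mxE.
  under [RHS]eq_bigr do rewrite !mxE.
  rewrite AX (bigD1 a) //= big1 => [|b /negPf ba].
    by rewrite !mxE eqxx mulr1n addr0 mulrC.
  by rewrite !mxE ba mulr0n mulr0.
have Pu : P \in unitmx.
  have : (\matrix_(a, i) (X a i)^*) *m P = 1%:M.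
    apply/matrixP => a b; rewrite !mxE -XX.
    by apply: eq_bigr => i _; rewrite !mxE.
  by move=> /mulmx1_unit[].
apply: prod_XsubC_eq; rewrite big_map big_enum /= -char_poly_eigenvalues.
rewrite -(char_poly_simil Pu PA) char_poly_trig ?diag_mx_is_trig //.
by apply: eq_bigr => a _; rewrite !mxE eqxx mulr1n.
Qed.

Lemma count_eigenvalues (R : realType) m (A : 'M[R[i]]_m) X d (p : pred R[i]) :
  eigenbasis A X d -> count p (eigenvalues A) = #|[pred a | p (d a)]|.
Proof.
move=> /eigenbasis_eigenvalues/permP->; rewrite count_map.
by rewrite -sum1_count big_enum_cond /= sum1dep_card cardsE.
Qed.

Lemma n_negN (R : realType) m (A : 'M[R[i]]_m) :
  (forall i j, A j i = (A i j)^*) -> n_neg (- A) = n_pos A.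
Proof.
move=> /hermitian_eigenbasis[X [d bA]].
have bN : eigenbasis (- A) X (fun a => - d a).
  case: bA => dr AX XX XX'; split=> // a; first by rewrite rpredN.
  move=> i; rewrite mulNr -AX -sumrN; apply: eq_bigr => j _.
  by rewrite !mxE mulNr.
rewrite /n_neg /n_pos (count_eigenvalues _ bA) (count_eigenvalues _ bN).
by apply: eq_card => a; rewrite !inE oppr_lt0.
Qed.

Lemma n_posDn_neg (R : realType) m (A : 'M[R[i]]_m) :
  (forall i j, A j i = (A i j)^*) -> \det A != 0 -> (n_pos A + n_neg A)%N = m.
Proof.
move=> /hermitian_eigenbasis[X [d bA]] detA.
have d0 a : d a != 0.
  apply: contraNneq detA => da0.
  (* An eigenvalue 0 would annul the constant coefficient of the characteristic polynomial, which is
     [\det A] up to sign. *)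
  have : root (char_poly A) 0.
    rewrite char_poly_eigenvalues root_prod_XsubC.
    by rewrite (perm_mem (eigenbasis_eigenvalues bA)) -da0 map_f ?mem_enum.
  by rewrite /root horner_coef0 char_poly_det mulf_eq0 signr_eq0.
rewrite /n_neg /n_pos !(count_eigenvalues _ bA) -[RHS]card_ord.
rewrite -(cardC [pred a | 0 < d a]); congr addn; apply: eq_card => a.
have [dr _ _ _] := bA; rewrite !inE.
by rewrite real_ltNge ?real0 // le_eqVlt eq_sym (negPf (d0 a)).
Qed.

(** The reciprocal of 1 plus the sum of all [(f i)^-1] is such a bound; it avoids minima in a
    partially ordered field, and the 1 covers an empty [P]. *)
Lemma finite_pos_bound (C : numFieldType) (I : finType) (P : pred I)
    (f : I -> C) : (forall i, P i -> 0 < f i) ->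
  exists2 e, 0 < e & forall i, P i -> e <= f i.
Proof.
move=> f0; pose s := 1 + \sum_(i | P i) (f i)^-1.
have s0 : 0 < s.
  by rewrite ltr_pwDl // sumr_ge0 // => i /f0 fi; rewrite invr_ge0 ltW.
exists s^-1; first by rewrite invr_gt0.
move=> i Pi; rewrite -[f i]invrK lef_pV2 ?posrE ?invr_gt0 ?f0 //.
rewrite /s (bigD1 i) //= addrCA lerDl addr_ge0 // sumr_ge0 // => j /andP[/f0].
by move=> fj _; rewrite invr_ge0 ltW.
Qed.

(* On the span of the negative eigenvectors of [A0] the form of a small
   perturbation stays negative, while this span would meet the span of the
   nonnegative eigenvectors of [A] if [A] had fewer negative eigenvalues. *)
Lemma n_neg_lsc (R : realType) m (A0 : 'M[R[i]]_m) :
  (forall i j, A0 j i = (A0 i j)^*) ->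
  exists2 e : R[i], 0 < e & forall A : 'M[R[i]]_m,
    (forall i j, A j i = (A i j)^*) ->
    (forall i j, `|A i j - A0 i j| <= e) -> (n_neg A0 <= n_neg A)%N.
Proof.
move=> /hermitian_eigenbasis[X0 [d0 bA0]].
have [d0r AX0 XX0 _] := bA0.
have [de de0 deP] : exists2 e, 0 < e & forall a, d0 a < 0 -> e <= - d0 a.
  by apply: finite_pos_bound => a; rewrite oppr_gt0.
(* [de] separates the negative eigenvalues of [A0] from 0. The [m * m] entries together change the
   form by less than [de] times the squared norm. *)
exists (de / (m * m).+1%:R); first by rewrite divr_gt0 ?ltr0Sn.
move=> A /hermitian_eigenbasis[X [d bA]] AA0.
have [dr AX _ XX'] := bA.
rewrite leqNgt; apply/negP; rewrite /n_neg (count_eigenvalues _ bA).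
rewrite (count_eigenvalues _ bA0).
(* The unknowns are coefficients on the negative eigenvectors of [A0]; the equations ask for
   orthogonality to the negative eigenvectors of [A]. *)
move=> /(kernel_vector (fun a b => \sum_i (X b i)^* * X0 a i)).
move=> [y [[a0 ya0] yP yQ]].
pose x i := \sum_a y a * X0 a i.
pose N := \sum_a `|y a| ^+ 2.
have N0 : 0 < N.
  rewrite /N (bigD1 a0) //= ltr_pwDl ?exprn_gt0 ?normr_gt0 //.
  by apply: sumr_ge0 => a _; rewrite exprn_ge0.
have xN : \sum_i `|x i| ^+ 2 = N.
  under eq_bigr do rewrite normCKC {1}/x rmorph_sum mulr_suml.
  rewrite exchange_big; apply: eq_bigr => a _ /=.
  under eq_bigr do rewrite mulr_sumr.
  rewrite exchange_big (bigD1 a) //= [X in _ + X]big1 => [|b ba].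
    under eq_bigr do rewrite rmorphM mulrACA.
    by rewrite -mulr_sumr XX0 eqxx normCKC mulr1 addr0.
  under eq_bigr do rewrite rmorphM mulrACA.
  by rewrite -mulr_sumr XX0 eq_sym (negPf ba) mulr0.
pose q (B : 'M[R[i]]_m) := \sum_i \sum_j (x i)^* * B i j * x j.
have qA0 : q A0 <= - de * N.
  have -> : q A0 = \sum_a d0 a * `|y a| ^+ 2.
    transitivity (\sum_i (x i)^* * \sum_a d0 a * y a * X0 a i).
      apply: eq_bigr => i _; under eq_bigr do rewrite -mulrA.
      rewrite -mulr_sumr; congr (_ * _); rewrite /x.
      under eq_bigr do rewrite mulr_sumr.
      rewrite exchange_big; apply: eq_bigr => a _ /=.
      by rewrite -mulrA mulrCA -AX0 mulr_sumr; apply: eq_bigr => k _; ring.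
    under eq_bigr do rewrite rmorph_sum mulr_suml.
    rewrite exchange_big; apply: eq_bigr => a _ /=.
    under eq_bigr do rewrite mulr_sumr.
    rewrite exchange_big (bigD1 a) //= [X in _ + X]big1 => [|b ba].
      under eq_bigr do rewrite rmorphM mulrACA.
      by rewrite -mulr_sumr XX0 eqxx normCKC mulr1 addr0 /=; ring.
    under eq_bigr do rewrite rmorphM mulrACA.
    by rewrite -mulr_sumr XX0 eq_sym (negPf ba) mulr0.
  rewrite mulr_sumr; apply: ler_sum => a _.
  have [da|/yP->] := boolP (d0 a < 0); last by rewrite normr0 expr0n !mulr0.
  by apply: ler_wpM2r; rewrite ?exprn_ge0 // lerNr deP.
have qA : 0 <= q A.
  have -> : q A = \sum_b d b * `|\sum_i (X b i)^* * x i| ^+ 2.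
    (* Spectral expansion of [A], obtained by inserting the resolution of the identity. *)
    have AE i j : A i j = \sum_b d b * X b i * (X b j)^*.
      transitivity (\sum_k A i k * (j == k)%:R).
        rewrite (bigD1 j) //= eqxx mulr1 big1 ?addr0 // => k.
        by rewrite eq_sym => /negPf->; rewrite mulr0.
      under eq_bigr do rewrite -XX' mulr_sumr.
      rewrite exchange_big; apply: eq_bigr => b _ /=.
      rewrite -AX mulr_suml; apply: eq_bigr => k _; ring.
    transitivity (\sum_i \sum_j \sum_b
        d b * ((X b i * (x i)^*) * ((X b j)^* * x j))).
      apply: eq_bigr => i _; apply: eq_bigr => j _.
      rewrite {1}AE [X in X * _]mulr_sumr [LHS]mulr_suml.
      by apply: eq_bigr => b _; ring.
    under eq_bigr do rewrite exchange_big.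
    rewrite exchange_big; apply: eq_bigr => b _ /=.
    rewrite normCKC rmorph_sum mulr_suml mulr_sumr; apply: eq_bigr => i _.
    rewrite mulr_sumr mulr_sumr; apply: eq_bigr => j _.
    by rewrite rmorphM /= conjCK.
  apply: sumr_ge0 => b _; have [db|] := boolP (d b < 0).
    suff -> : \sum_i (X b i)^* * x i = 0 by rewrite normr0 expr0n mulr0.
    rewrite -[RHS](yQ b db) /x.
    under eq_bigr do rewrite mulr_sumr.
    rewrite exchange_big; apply: eq_bigr => a _ /=.
    by rewrite mulr_sumr; apply: eq_bigr => i _; rewrite mulrCA.
  by rewrite -real_leNgt ?real0 // => db; rewrite mulr_ge0 ?exprn_ge0.
have qAA0 : `|q A - q A0| <= (m * m)%:R * (de / (m * m).+1%:R * N).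
  rewrite /q -sumrB; apply: le_trans (ler_norm_sum _ _ _) _.
  apply: le_trans (_ : \sum_(i < m) \sum_(j < m) (de / (m * m).+1%:R * N) <= _);
    last by rewrite !sumr_const !card_ord -mulrnA mulr_natl.
  apply: ler_sum => i _; rewrite -sumrB.
  apply: le_trans (ler_norm_sum _ _ _) _; apply: ler_sum => j _.
  have -> : (x i)^* * A i j * x j - (x i)^* * A0 i j * x j =
    (A i j - A0 i j) * ((x i)^* * x j) by ring.
  rewrite normrM ler_pM ?normr_ge0 // normrM norm_conjC.
  have xle k : `|x k| ^+ 2 <= N.
    rewrite -xN (bigD1 k) //= lerDl; apply: sumr_ge0 => l _.
    exact: exprn_ge0.
  rewrite -(@ler_pXn2r _ 2) ?nnegrE ?mulr_ge0 ?(ltW N0) //.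
  by rewrite exprMn [leRHS]expr2 ler_pM ?exprn_ge0.
suff : q A < 0 by rewrite (le_gtF qA).
(* The order on [R[i]] is partial, so bounding a value by its modulus first requires it to be
   real. *)
have qr : q A - q A0 \is Num.real.
  apply: rpredB; first exact: ger0_real.
  apply: ler0_real; apply: le_trans qA0 _.
  by rewrite mulNr oppr_le0 mulr_ge0 ?ltW.
rewrite -[q A](subrK (q A0)).
apply: le_lt_trans (lerD (le_trans (real_ler_norm qr) qAA0) qA0) _.
rewrite mulNr subr_lt0 mulrA ltr_pM2r // mulrCA gtr_pMr //.
by rewrite ltr_pdivrMr ?ltr0Sn // mul1r ltr_nat.
Qed.

(** * Fourier analysis of circulant graphs *)

Section Expi.
Context {R : realType}.
Implicit Types s t : R.

Lemma expiD s t : expi (s + t) = expi s * expi t.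
Proof.
rewrite /expi cosD sinD; congr Complex.
by rewrite addrC mulrC [X in _ + X]mulrC.
Qed.

Lemma expi0 : expi 0 = 1 :> R[i].
Proof. by rewrite /expi cos0 sin0. Qed.

Lemma expi_neq0 t : expi t != 0.
Proof.
have e1 : expi t * expi (- t) = 1 by rewrite -expiD subrr expi0.
by apply: contra_eq_neq e1 => ->; rewrite mul0r eq_sym oner_neq0.
Qed.

Lemma expiN t : expi (- t) = (expi t)^-1.
Proof.
apply: (mulfI (expi_neq0 t)).
by rewrite -expiD subrr expi0 divff ?expi_neq0.
Qed.

Lemma conj_expi t : (expi t)^* = expi (- t).
Proof. by rewrite /expi cosN sinN. Qed.

Lemma expi_exprn t n : expi t ^+ n = expi (t *+ n).
Proof.
elim: n => [|n IH]; first by rewrite expr0 mulr0n expi0.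
by rewrite exprS IH mulrS expiD.
Qed.

Lemma expi_exprz t (d : int) : exprz (expi t) d = expi (t *~ d).
Proof.
case: d => n; first by rewrite -exprnP expi_exprn.
by rewrite NegzE -exprnN expi_exprn mulrNz expiN.
Qed.

Lemma expi_2pi : expi (pi *+ 2 : R) = 1.
Proof. by rewrite /expi cos2pi sin2pi. Qed.

(** With [t = 2x], [cos t = 1] forces [sin x = 0], and the sine has no zero strictly between 0 and
    pi. *)
Lemma expi_eq1 t : - (pi *+ 2) < t < pi *+ 2 -> expi t = 1 -> t = 0.
Proof.
move=> /andP[tl tr] [cost _]; pose x := t / 2.
have tE : t = x *+ 2 by rewrite /x -mulr_natr mulfVK.
have sinx : sin x = 0.
  apply/eqP; rewrite -sqrf_eq0 sin2cos2; apply/eqP.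
  by move: cost; rewrite tE cos_mulr2n; lra.
have [x0|x0|x0] := ltgtP 0 x; last by rewrite tE -x0 mul0rn.
- have : 0 < sin x by apply: sin_gt0_pi; rewrite x0 /=; move: tr; rewrite tE; lra.
  by rewrite sinx ltxx.
- have : 0 < sin (- x).
    by apply: sin_gt0_pi; rewrite oppr_gt0 x0 /=; move: tl; rewrite tE; lra.
  by rewrite sinN sinx oppr0 ltxx.
Qed.

(** A geometric sum whose ratio is an [n]-th root of unity; the ratio is 1 only for [k = k'],
    because [k' - k] lies strictly between [-n] and [n]. *)
Lemma sum_expi_ortho n (k k' : 'I_n) :
  \sum_(u < n) (expi (pi *+ 2 * k%:R / n%:R) ^+ u)^*
    * expi (pi *+ 2 * k'%:R / n%:R) ^+ u = n%:R * (k == k')%:R :> R[i].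
Proof.
have n0 : (0 < n)%N by apply: leq_ltn_trans (ltn_ord k).
have n0R : 0 < n%:R :> R by rewrite ltr0n.
pose t := pi *+ 2 * (k'%:R - k%:R) / n%:R : R.
transitivity (\sum_(u < n) expi t ^+ u).
  apply: eq_bigr => u _; rewrite rmorphXn /= -exprMn_comm; last exact: mulrC.
  by rewrite conj_expi -expiD; congr (expi _ ^+ _); rewrite /t; ring.
have [kE|kk'] := eqVneq k k'.
  rewrite /t kE subrr mulr0 mul0r expi0 mulr1.
  under eq_bigr do rewrite expr1n.
  by rewrite sumr_const card_ord.
rewrite mulr0; apply/eqP.
have t1 : expi t != 1.
  apply: contraNneq kk' => /expi_eq1 t0; apply/eqP/val_inj/eqP => /=.
  have pi20 : 0 < pi *+ 2 :> R by rewrite mulrn_wgt0 ?pi_gt0.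
  have /t0/eqP : - (pi *+ 2) < t < pi *+ 2.
    have kn : k%:R < n%:R :> R by rewrite ltr_nat.
    have kn' : k'%:R < n%:R :> R by rewrite ltr_nat.
    have k0 : 0 <= k%:R :> R by [].
    have k0' : 0 <= k'%:R :> R by [].
    rewrite /t ltr_pdivlMr // ltr_pdivrMr //.
    rewrite mulNr -mulrN !(ltr_pM2l pi20).
    by apply/andP; split; lra.
  rewrite /t !mulf_eq0 invr_eq0 (gt_eqF n0R) orbF.
  by rewrite (gt_eqF pi20) subr_eq0 eqr_nat eq_sym.
have := subrX1 (expi t) n; rewrite expi_exprn.
have -> : t *+ n = (pi *+ 2) *~ (k'%:Z - k%:Z).
  rewrite -mulrzr rmorphB /= -mulr_natr /t divfK ?gt_eqF //.
rewrite -expi_exprz expi_2pi exp1rz subrr => /esym/eqP.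
by rewrite mulf_eq0 subr_eq0 (negPf t1).
Qed.

End Expi.

(** On the unit circle conjugation inverts [z], and negation maps [D i j] onto [D j i]. The two
    lists may be ordered differently, hence the permutation. *)
Lemma laurent_eval_hermitian (R : realType) m (D : 'I_m -> 'I_m -> seq int) c t :
  is_diff_matrix D -> self_conjugate c -> forall i j,
  laurent_eval D c (expi t : R[i]) j i = (laurent_eval D c (expi t) i j)^*.
Proof.
move=> Ddiff csc i j; rewrite !mxE rmorph_sum.
have /(perm_big _)-> : perm_eq (undup (D j i)) (map -%R (undup (D i j))).
  apply: uniq_perm => [||d]; first exact: undup_uniq.
    by rewrite (map_inj_uniq oppr_inj) undup_uniq.
  by rewrite mem_undup Ddiff -[d in RHS]opprK (mem_map oppr_inj) mem_undup.
rewrite big_map; apply: eq_bigr => d _.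
by rewrite rmorphM csc opprK /= !expi_exprz conj_expi mulrNz.
Qed.

(** The congruence has the single solution [(u + d) mod n] in range. Exponential vectors are thus
    eigenvectors of cyclic shifts. *)
Lemma sum_exprz_shift (K : fieldType) (w : K) n (u : 'I_n) (d : int) :
  w != 0 -> w ^+ n = 1 ->
  \sum_(v < n | ((v : nat)%:Z - (u : nat)%:Z == d %[mod n%:Z])%Z) w ^+ v
  = w ^+ u * exprz w d.
Proof.
move=> w0 wn.
have n0 : (0 < n)%N by apply: leq_ltn_trans (ltn_ord u).
have n0Z : n%:Z != 0 by rewrite eqz_nat -lt0n.
pose r := ((u%:Z + d) %% n%:Z)%Z.
have r0 : 0 <= r by exact: modz_ge0.
have rn : (absz r < n)%N.
  by rewrite -ltz_nat gez0_abs // ltz_mod // /r.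
rewrite (big_pred1 (Ordinal rn)) => [|v] /=.
  rewrite exprnP gez0_abs // exprnP -expfzDr //.
  rewrite [in RHS](divz_eq (u%:Z + d) n) [RHS]expfzDr //.
  by rewrite [(_ %/ _)%Z * _ in RHS]mulrC -exprz_exp -exprnP wn exp1rz mul1r.
rewrite -(inj_eq val_inj) /= -eqz_nat gez0_abs //.
rewrite eqz_mod_dvd -[(_ - _ - _)%R]/(v%:Z - u%:Z - d).
rewrite -addrA -opprD -eqz_mod_dvd /r.
by rewrite [in LHS]modz_small // le0z_nat /= ltz_nat ltn_ord.
Qed.

Lemma alpha_G_attained m (D : 'I_m -> 'I_m -> seq int) n :
  exists2 S : {set 'I_m * 'I_n}, circ_indep D S & alpha_G D n = #|S|.
Proof.
have ind0 : @circ_indep m D n finset.set0.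
  by apply/forallP => x; rewrite finset.in_set0.
rewrite /alpha_G (bigop.bigmax_eq_arg finset.set0) //.
by case: arg_maxnP => // S indS _; exists S.
Qed.

(** [inertia_bound] is applied to the weight matrix [A] of [G_n]. Its eigenvectors [X (k, a)] are
    products of the Fourier character of [w k] with an eigenvector of [F k], and have squared norm
    [n]. *)
Lemma circ_inertia (R : realType) m (D : 'I_m -> 'I_m -> seq int)
    (c : 'I_m -> 'I_m -> int -> R[i]) n :
  is_diff_matrix D -> self_conjugate c ->
  (alpha_G D n + \sum_(k < n)
     n_neg (laurent_eval D c (expi (pi *+ 2 * k%:R / n%:R : R))) <= n * m)%N.
Proof.
move=> Ddiff csc.
have [S indS ->] := alpha_G_attained D n.
pose w (k : 'I_n) : R[i] := expi (pi *+ 2 * k%:R / n%:R).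
pose F k := laurent_eval D c (w k).
have /choice[Xd Xd_basis] k : exists Xd, eigenbasis (F k) Xd.1 Xd.2.
  have [X [d Xd]] := hermitian_eigenbasis (laurent_eval_hermitian
    (pi *+ 2 * k%:R / n%:R) Ddiff csc).
  by exists (X, d).
(* Several differences may agree modulo [n]; their weights are added. *)
pose A (x y : 'I_m * 'I_n) := \sum_(d <- undup (D x.1 y.1) |
  ((y.2 : nat)%:Z - (x.2 : nat)%:Z == d %[mod n%:Z])%Z) c x.1 y.1 d.
pose X (p : 'I_n * 'I_m) (x : 'I_m * 'I_n) := (Xd p.1).1 p.2 x.1 * w p.1 ^+ x.2.
pose l (p : 'I_n * 'I_m) := (Xd p.1).2 p.2.
have cardP : #|[pred p | l p < 0]| = (\sum_k n_neg (F k))%N.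
  rewrite -sum1_card.
  under [RHS]eq_bigr do rewrite /n_neg (count_eigenvalues _ (Xd_basis _))
    -sum1_card.
  by rewrite pair_big_dep; apply: eq_bigl => -[].
rewrite addnC -cardP.
have -> : (n * m)%N = #|{: 'I_m * 'I_n}| by rewrite card_prod !card_ord mulnC.
(* [n = 0] is set apart because the squared norm [n] must be positive. *)
case: (posnP n) => [n0|n0].
  have noI (u : 'I_n) : False by have := ltn_ord u; rewrite [X in (_ < X)%N]n0.
  have -> : #|S| = 0%N by apply: eq_card0 => -[i u]; case: (noI u).
  have -> : #|[pred p | l p < 0]| = 0%N.
    by apply: eq_card0 => -[u i]; case: (noI u).
  exact: leq0n.
apply: (@inertia_bound _ _ _ _ S A X l n%:R); first by rewrite ltr0n.
(* Summing over [v] turns each cyclic shift into a power of [w k], which leaves the eigenvector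
   equation of [F k]. *)
- move=> [k a] [i u]; rewrite /X /l /=.
  have [_ FX _ _] := Xd_basis k.
  transitivity (\sum_j \sum_v A (i, u) (j, v) * ((Xd k).1 a j * w k ^+ v)).
    by rewrite pair_big; apply: eq_bigr => -[].
  rewrite mulrA -FX mulr_suml; apply: eq_bigr => j _.
  rewrite !mxE /A /=.
  under eq_bigr do rewrite big_mkcond mulr_suml.
  rewrite exchange_big /= !mulr_suml; apply: eq_bigr => d _.
  transitivity (c i j d * (Xd k).1 a j *
    \sum_(v < n | ((v : nat)%:Z - (u : nat)%:Z == d %[mod n%:Z])%Z) w k ^+ v).
    rewrite [in RHS]big_mkcond mulr_sumr; apply: eq_bigr => v _.
    by case: ifP => _; rewrite ?mulrA // !(mulr0, mul0r).
  rewrite sum_exprz_shift ?expi_neq0 //; first by ring.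
  rewrite expi_exprn -[_ *+ n]mulr_natr divfK ?pnatr_eq0 -?lt0n //.
  by rewrite mulr_natr -expi_exprn expi_2pi expr1n.
- move=> [k a] [k' b]; rewrite /X /=.
  transitivity (\sum_i \sum_(u < n) ((Xd k).1 a i)^* * (Xd k').1 b i
    * ((w k ^+ u)^* * w k' ^+ u)).
    rewrite pair_big; apply: eq_bigr => -[i u] _ /=.
    by rewrite rmorphM mulrACA.
  under eq_bigr do rewrite -mulr_sumr sum_expi_ortho.
  rewrite -mulr_suml mulrCA; congr (_ * _); rewrite xpair_eqE.
  have [<-|_] := eqVneq k k'; last by rewrite mulr0.
  by have [_ _ -> _] := Xd_basis k; rewrite mulr1.
- by [].
(* Independence leaves no difference that satisfies the congruence, so the sum is empty. *)
- move=> x y xS yS; rewrite /A big1_seq // => d /andP[dxy].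
  rewrite mem_undup => dD.
  have /'forall_in_forall_inP/(_ x xS y yS)/hasPn/(_ d dD) := indS.
  by rewrite dxy.
Qed.

(** * Convergence of the independence densities *)

(** This bound prevents wrap-around in [G_k] and keeps the exponents of [shifted_poly_mx]
    nonnegative. *)
Lemma diff_le_shiftN m (D : 'I_m -> 'I_m -> seq int) i j d :
  d \in D i j -> (absz d <= shiftN D)%N.
Proof.
move=> dD; rewrite /shiftN (bigD1 i) //= (bigD1 j) //= (big_rem d dD) /=.
by rewrite -!addnA leq_addr.
Qed.

Lemma alpha_G_le m (D : 'I_m -> 'I_m -> seq int) n : (alpha_G D n <= n * m)%N.
Proof.
have [S _ ->] := alpha_G_attained D n.
by rewrite (leq_trans (max_card _)) // card_prod !card_ord mulnC.
Qed.

(* Repeat an independent set of [G_n] periodically in [G_k] and delete the last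
   [shiftN D] layers, so that no difference wraps around modulo [k]. *)
Lemma alpha_G_periodic m (D : 'I_m -> 'I_m -> seq int) n k : (0 < n)%N ->
  (k %/ n * alpha_G D n <= alpha_G D k + shiftN D * m)%N.
Proof.
move=> n0; have [S indS ->] := alpha_G_attained D n.
set K := shiftN D; set q := (k %/ n)%N.
pose red (x : 'I_m * 'I_k) : 'I_m * 'I_n := (x.1, Ordinal (ltn_pmod x.2 n0)).
pose Sk := [set x : 'I_m * 'I_k | (x.2 + K < k)%N && (red x \in S)]%SET.
pose Tk := [set x : 'I_m * 'I_k | (k <= x.2 + K)%N]%SET.
have phiP (p : 'I_q * ('I_m * 'I_n)) : (p.1 * n + p.2.2 < k)%N.
  apply: leq_trans (leq_trunc_div k n); rewrite -/q.
  by have := ltn_ord p.1; have := ltn_ord p.2.2; nia.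
pose phi p : 'I_m * 'I_k := (p.2.1, Ordinal (phiP p)).
have phi_inj : injective phi.
  move=> [a [i u]] [b [j v]] [-> /= e]; have := congr1 (modn^~ n) e.
  have := congr1 (divn^~ n) e; rewrite !divnMDl // !modnMDl !divn_small //.
  by rewrite !modn_small // !addn0 => /val_inj-> /val_inj->.
have indSk : circ_indep D Sk.
  apply/'forall_in_forall_inP => x; rewrite finset.inE => /andP[xk xS] y.
  rewrite finset.inE => /andP[yk yS]; apply/negP => /hasP[d dD].
  rewrite eqz_mod_dvd => /dvdzP[l lE].
  have /'forall_in_forall_inP/(_ _ xS _ yS)/hasPn/(_ d dD)/negP := indS.
  apply; rewrite eqz_mod_dvd /=.
  have dK := diff_le_shiftN dD; rewrite -/K in dK.
  have xk' := ltn_ord x.2; have yk' := ltn_ord y.2.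
  (* [x.2] and [y.2] are below [k - K] and [d] is at most [K] in modulus, so [y.2 - x.2 - d] lies
     strictly between [-k] and [k]: the congruence modulo [k] is an equality. *)
  have l0 : l = 0 by nia.
  apply/dvdzP; exists ((x.2 %/ n)%N%:Z - (y.2 %/ n)%N%:Z).
  have ex := divn_eq x.2 n; have ey := divn_eq y.2 n.
  move: lE; rewrite l0 mul0r {1}ex {1}ey !PoszD !PoszM => lE.
  lia.
(* A repeated point outside the last [K] layers lies in [Sk], so the copies lose at most [#|Tk|]
   points. *)
have sub : (phi @: finset.setX [set: 'I_q]%SET S \subset Sk :|: Tk)%SET.
  apply/fintype.subsetP => _ /imsetP[[a [i u]] /finset.setXP[_ uS] ->].
  rewrite !finset.inE /= ltnNge; case: leqP => //= _; rewrite orbF.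
  rewrite (_ : red _ = (i, u)) //; congr pair; apply: val_inj => /=.
  by rewrite modnMDl modn_small.
have cardT : (#|Tk| <= K * m)%N.
  have -> : Tk = finset.setX [set: 'I_m]%SET [set u : 'I_k | (k <= u + K)%N]%SET.
    by apply/finset.setP => -[i u]; rewrite !finset.inE.
  rewrite cardsX cardsT card_ord mulnC leq_mul2r; apply/orP; right.
  have [k0|k0] := posnP k.
    by rewrite eq_card0 // => u; have := ltn_ord u; rewrite [X in (_ < X)%N]k0.
  (* [f] numbers the layers from the end. On the last [K] layers its values stay below [K], so the
     extra element of ['I_K.+1], present for [inord], is never hit. *)
  pose f (u : 'I_k) : 'I_K.+1 := inord (k.-1 - u)%N.
  have finj : {in [set u : 'I_k | (k <= u + K)%N]%SET &, injective f}.
    move=> u v; rewrite !finset.inE => uK vK /(congr1 val).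
    have uk := ltn_ord u; have vk := ltn_ord v.
    by rewrite /f /= !inordK; try lia; move=> e; apply: val_inj => /=; lia.
  rewrite -(card_in_imset finj).
  have : (f @: [set u : 'I_k | (k <= u + K)%N]%SET \subset
          [set~ (ord_max : 'I_K.+1)])%SET.
    apply/fintype.subsetP => _ /imsetP[u + ->]; rewrite !finset.inE => uK.
    have uk := ltn_ord u.
    by rewrite -(inj_eq val_inj) /= inordK; lia.
  by move=> /subset_leq_card; rewrite cardsC1 card_ord.
have := subset_leq_card sub; rewrite card_imset // cardsX cardsT card_ord.
move=> /leq_trans; apply; apply: leq_trans (leq_card_setU _ _) _.
by apply: leq_add => //; rewrite /alpha_G; apply: (bigop.leq_bigmax_cond Sk).
Qed.

(** The limit is the supremum of the densities: once [n] has density near it, [xle] keeps the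
    density of every large [k] almost as high. *)
Lemma cvg_alpha_G (R : realType) m (D : 'I_m -> 'I_m -> seq int) :
  cvgn (fun n : nat => (alpha_G D n)%:R / (n * m)%:R : R).
Proof.
set x := fun n : nat => _.
have [m0|m0] := posnP m.
  rewrite (_ : x = fun=> 0); first exact: is_cvg_cst.
  by apply/funext => n; rewrite /x [X in (_ * X)%N]m0 muln0 invr0 mulr0.
have m0R : 0 < m%:R :> R by rewrite ltr0n.
pose K := shiftN D.
have x_ge0 n : 0 <= x n by rewrite divr_ge0.
have xle n k : (0 < k)%N -> x n <= x k + (n + K)%:R / k%:R.
  move=> k0; have k0R : 0 < k%:R :> R by rewrite ltr0n.
  have [->|n0] := posnP n.
    by rewrite {1}/x mul0n invr0 mulr0 addr_ge0 ?divr_ge0.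
  have n0R : 0 < n%:R :> R by rewrite ltr0n.
  (* Denominators cleared: [n * K * m] pays for the deleted layers, [n * (n * m)] for the incomplete
     block of [k %% n] layers. *)
  have h : (k * alpha_G D n <= n * alpha_G D k + n * K * m + n * (n * m))%N.
    have h1 := alpha_G_periodic D k n0; have h2 := alpha_G_le D n.
    have h3 := divn_eq k n; have h4 := ltn_pmod k n0.
    rewrite -/K in h1; rewrite {1}h3 mulnDl.
    apply: leq_add; last by apply: leq_mul => //; exact: ltnW.
    by have := leq_mul (leqnn n) h1; rewrite mulnDr; nia.
  rewrite /x !natrM -(ler_pM2r (mulr_gt0 (mulr_gt0 n0R m0R) k0R)).
  have -> : (alpha_G D n)%:R / (n%:R * m%:R) * (n%:R * m%:R * k%:R)
    = k%:R * (alpha_G D n)%:R :> R by field; rewrite !gt_eqF.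
  have -> : ((alpha_G D k)%:R / (k%:R * m%:R) + (n + K)%:R / k%:R) *
      (n%:R * m%:R * k%:R)
    = n%:R * (alpha_G D k)%:R + n%:R * K%:R * m%:R + n%:R * (n%:R * m%:R) :> R.
    by rewrite natrD; field; rewrite !gt_eqF.
  by rewrite -!natrM -!natrD ler_nat.
have x_le1 n : x n <= 1.
  have [->|n0] := posnP n; first by rewrite /x mul0n invr0 mulr0.
  by rewrite ler_pdivrMr ?ltr0n ?muln_gt0 ?n0 // mul1r ler_nat alpha_G_le.
have hs : has_sup (range x).
  split; first by exists (x 0); exists 0.
  by exists 1 => _ [n _ <-].
apply/cvg_ex; exists (sup (range x)); apply/cvgrPdist_le => e e0.
have e20 : 0 < e / 2 by rewrite divr_gt0.
have [_ [n _ <-] nL] := sup_adherent e20 hs.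
near=> k.
have k0 : (0 < k)%N by near: k; exact: nbhs_infty_gt.
have k0R : 0 < k%:R :> R by rewrite ltr0n.
have kL : x k <= sup (range x) by apply: sup_upper_bound => //; exists k.
have ke : (n + K)%:R / k%:R <= e / 2.
  rewrite ler_pdivrMr // mulrC -ler_pdivrMr //.
  by near: k; exact: nbhs_infty_ger.
rewrite ger0_norm ?subr_ge0 //.
have := xle n k k0; lra.
Unshelve. all: by end_near. Qed.

(** * Integration over the unit circle *)

Lemma mulrz_continuous (R : realType) (d : int) :
  continuous (fun t : R => t *~ d).
Proof.
rewrite (_ : (fun _ => _) = ( *%R (d%:~R : R))); first exact: mulrl_continuous.
by apply/funext => t; rewrite mulrzl.
Qed.

(** Both parts are trigonometric polynomials, as induction on the list of differences shows:
    [a + bi] times [z^d] contributes [a cos(td) - b sin(td)] and [a sin(td) + b cos(td)]. *)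
Lemma laurent_at_continuous (R : realType) m (D : 'I_m -> 'I_m -> seq int)
    (c : 'I_m -> 'I_m -> int -> R[i]) i j :
  continuous (fun t : R => complex.Re (laurent_eval D c (expi t) i j)) /\
  continuous (fun t : R => complex.Im (laurent_eval D c (expi t) i j)).
Proof.
under [X in continuous X /\ _]eq_fun do rewrite mxE.
under [X in _ /\ continuous X]eq_fun do rewrite mxE.
elim: (undup (D i j)) => [|d s [IHr IHi]].
  under [X in continuous X /\ _]eq_fun do rewrite big_nil.
  under [X in _ /\ continuous X]eq_fun do rewrite big_nil.
  by split; exact: cst_continuous.
have cc : continuous (fun t : R => cos (t *~ d)).
  move=> t; apply: continuous_comp; last exact: continuous_cos.
  exact: mulrz_continuous.
have cs : continuous (fun t : R => sin (t *~ d)).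
  move=> t; apply: continuous_comp; last exact: continuous_sin.
  exact: mulrz_continuous.
case cE: (c i j d) => [a b].
pose rest t := \sum_(e <- s) c i j e * exprz (expi t : R[i]) e.
split.
  rewrite (_ : (fun _ => _) = fun t => a * cos (t *~ d) - b * sin (t *~ d)
      + complex.Re (rest t)); last first.
    apply/funext => t; rewrite big_cons cE expi_exprz -/(rest t) /expi.
    by case: (rest t).
  move=> t; apply: cvgD; last exact: IHr.
  by apply: cvgB; apply: cvgMr; [exact: cc|exact: cs].
rewrite (_ : (fun _ => _) = fun t => a * sin (t *~ d) + b * cos (t *~ d)
    + complex.Im (rest t)); last first.
  apply/funext => t; rewrite big_cons cE expi_exprz -/(rest t) /expi.
  by case: (rest t).
move=> t; apply: cvgD; last exact: IHi.
by apply: cvgD; apply: cvgMr; [exact: cs|exact: cc].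
Qed.

Lemma normc_le_ReIm (R : realType) (z : R[i]) :
  `|z| <= (`|complex.Re z| + `|complex.Im z|)%:C%C.
Proof.
rewrite normc_def lecR -(ler_pXn2r (_ : 0 < 2)%N) ?nnegrE ?sqrtr_ge0 ?addr_ge0 //.
rewrite sqr_sqrtr ?addr_ge0 ?sqr_ge0 // sqrrD !real_normK ?num_real //.
by rewrite addrAC lerDl mulrn_wge0 // mulr_ge0.
Qed.

Lemma dist_le_ReIm (R : realType) (z w : R[i]) (r : R) :
  `|complex.Re w - complex.Re z| <= r / 2 ->
  `|complex.Im w - complex.Im z| <= r / 2 -> `|z - w| <= r%:C%C.
Proof.
move=> hr hi; rewrite distrC (le_trans (normc_le_ReIm _)) // lecR.
by move: z w hr hi => [a b] [a' b'] /=; lra.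
Qed.

(** The finitely many entries are continuous, so near [t0] all of them stay within the tolerance of
    [n_neg_lsc]. *)
Lemma n_neg_laurent_lsc (R : realType) m (D : 'I_m -> 'I_m -> seq int) c (t0 : R) :
  is_diff_matrix D -> self_conjugate c ->
  \forall t \near t0, (n_neg (laurent_eval D c (expi t0))
                       <= n_neg (laurent_eval D c (expi t)))%N.
Proof.
move=> Ddiff csc.
have [e e0 He] := n_neg_lsc (laurent_eval_hermitian t0 Ddiff csc).
pose r := complex.Re e.
have [r0 eE] : 0 < r /\ e = r%:C%C.
  by move: e0; rewrite ltcE /r; case: (e) => a b /= /andP[/eqP -> ->].
pose small (ij : 'I_m * 'I_m) (t : R) :=
  `|laurent_eval D c (expi t) ij.1 ij.2
    - laurent_eval D c (expi t0) ij.1 ij.2| <= e.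
have : \forall t \near t0, forall ij, small ij t.
  refine (@filter_forall R ('I_m * 'I_m)%type small (nbhs t0) _ _) => -[i j].
  rewrite /small /=.
  have [cr ci] := laurent_at_continuous D c i j.
  have r20 : 0 < r / 2 by rewrite divr_gt0.
  have /cvgrPdist_le/(_ _ r20) hr := cr t0.
  have /cvgrPdist_le/(_ _ r20) hi := ci t0.
  near=> t.
  have h1 : `|complex.Re (laurent_eval D c (expi t0) i j)
    - complex.Re (laurent_eval D c (expi t) i j)| <= r / 2 by near: t.
  have h2 : `|complex.Im (laurent_eval D c (expi t0) i j)
    - complex.Im (laurent_eval D c (expi t) i j)| <= r / 2 by near: t.
  by rewrite eE; exact: dist_le_ReIm.
apply: filterS => t tP; apply: He; first exact: laurent_eval_hermitian.
by move=> i j; exact: (tP (i, j)).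
Unshelve. all: by end_near. Qed.

Lemma measurable_n_neg (R : realType) m (D : 'I_m -> 'I_m -> seq int) c
    (B : set R) : is_diff_matrix D -> self_conjugate c -> measurable B ->
  measurable_fun B
    (fun t : R => (n_neg (laurent_eval D c (expi t)))%:R%:E : \bar R).
Proof.
move=> Ddiff csc mB; apply: (@measurable_funS _ _ _ _ setT) => //.
apply: lower_semicontinuous_measurable => t a at0.
exists [set s : R | (n_neg (laurent_eval D c (expi t))
                     <= n_neg (laurent_eval D c (expi s)))%N]%classic.
  exact: n_neg_laurent_lsc.
by move=> s /= ts; apply: lt_le_trans at0 _; rewrite lee_fin ler_nat.
Qed.

(** * Step functions and Riemann sums on the circle *)

Section StepFunctions.
Context {R : realType}.

(** Half-open, so that for [n > 0] the arcs with [k < n] partition the interval from 0 to [2 pi];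
    their left ends are the sample points of [circ_inertia]. *)
Definition arc n k : set R :=
  `[pi *+ 2 * k%:R / n%:R, pi *+ 2 * k.+1%:R / n%:R[%classic.

Definition step_fun (h : R -> nat) n (t : R) : \bar R :=
  (\sum_(k < n) (h (pi *+ 2 * k%:R / n%:R))%:R%:E * (\1_(arc n k) t)%:E)%E.

Let pi20 : 0 < pi *+ 2 :> R. Proof. by rewrite mulrn_wgt0 ?pi_gt0. Qed.

Lemma scaled_indic_ge0 (a : nat) (A : set R) t :
  (0 <= a%:R%:E * (\1_A t)%:E :> \bar R)%E.
Proof. by rewrite -EFinM lee_fin mulr_ge0. Qed.

Lemma measurable_indic_arc n k B : measurable B ->
  measurable_fun B (fun t => (\1_(arc n k) t)%:E : \bar R).
Proof.
move=> mB; apply/measurable_EFinP; apply: measurable_funTS.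
by apply: measurable_indic; exact: measurable_itv.
Qed.

Lemma measurable_step_fun h n B : measurable B -> measurable_fun B (step_fun h n).
Proof.
move=> mB; apply: emeasurable_sum => k; apply: emeasurable_funM => //.
exact: measurable_indic_arc.
Qed.

Lemma step_fun_ge0 h n t : (0 <= step_fun h n t)%E.
Proof.
by apply: sume_ge0 => k _; exact: scaled_indic_ge0.
Qed.

Lemma lebesgue_measure_arc n k : (0 < n)%N ->
  lebesgue_measure (arc n k) = (pi *+ 2 / n%:R)%:E.
Proof.
move=> n0; have n0R : 0 < n%:R :> R by rewrite ltr0n.
rewrite /arc lebesgue_measure_itv /= lte_fin.
rewrite ltr_pM2r ?invr_gt0 // ltr_pM2l // ltr_nat ltnSn -EFinB.
by congr EFin; rewrite -natr1; ring.
Qed.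

Lemma integral_step_fun h n : (0 < n)%N ->
  (\int[@lebesgue_measure R]_(t in `[0%R, (pi *+ 2)%R[) step_fun h n t)%E =
  ((\sum_(k < n) h (pi *+ 2 * k%:R / n%:R))%N%:R * (pi *+ 2 / n%:R))%:E.
Proof.
move=> n0; have n0R : 0 < n%:R :> R by rewrite ltr0n.
rewrite ge0_integral_sum //; last first.
  by move=> k; apply: emeasurable_funM => //; exact: measurable_indic_arc.
rewrite natr_sum mulr_suml -sumEFin; apply: eq_bigr => k _.
rewrite ge0_integralZl_EFin //; last first.
  exact: measurable_indic_arc.
rewrite integral_indic //; last exact: measurable_itv.
rewrite setIidl; last first.
  move=> t; rewrite /arc /= !in_itv /= => /andP[kt tk]; apply/andP; split.
    by apply: le_trans kt; rewrite divr_ge0 // mulr_ge0 // ltW.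
  apply: lt_le_trans tk _; rewrite ler_pdivrMr // ler_pM2l // ler_nat.
  exact: ltn_ord.
by rewrite [X in (_ * X)%E](lebesgue_measure_arc k n0) -EFinM.
Qed.

(** For large [n] the arc containing [t] is shorter than the radius [e] within which [h] is at least
    [h t], so the sample at its left end is at least [h t]. *)
Lemma step_fun_liminf (h : R -> nat) (t : R) : 0 <= t < pi *+ 2 ->
  (\forall s \near t, (h t <= h s)%N) ->
  ((h t)%:R%:E <= limn_einf (step_fun h ^~ t))%E.
Proof.
move=> /andP[t0 t2] [e /= e0 he]; rewrite limn_einf_lim.
apply: lime_ge; first exact: is_cvg_einfs.
near=> N; apply: le_ereal_inf_tmp => _ [n /= Nn <-].
have n0 : (0 < n)%N.
  by apply: leq_trans Nn; near: N; exact: nbhs_infty_gt.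
have n0R : 0 < n%:R :> R by rewrite ltr0n.
have ne : pi *+ 2 / n%:R < e.
  rewrite ltr_pdivrMr // mulrC -ltr_pdivrMr //.
  apply: lt_le_trans (_ : N%:R <= _); last by rewrite ler_nat.
  by near: N; exact: nbhs_infty_gtr.
(* The index of the arc that contains [t]; [t < 2 pi] gives [k < n]. *)
pose k := Num.truncn (t * n%:R / (pi *+ 2)).
have /truncn_itv/andP[kt tk] : 0 <= t * n%:R / (pi *+ 2).
  by rewrite divr_ge0 ?mulr_ge0 // ltW.
rewrite -/k in kt tk.
have kt' : pi *+ 2 * k%:R / n%:R <= t.
  by rewrite ler_pdivrMr // mulrC -ler_pdivlMr.
have tk' : t < pi *+ 2 * k.+1%:R / n%:R.
  by rewrite ltr_pdivlMr // mulrC -mulrC [pi *+ 2 * _]mulrC -ltr_pdivrMr.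
have kn : (k < n)%N.
  rewrite -(ltr_nat R); apply: le_lt_trans kt _.
  by rewrite ltr_pdivrMr // mulrC ltr_pM2l.
rewrite /step_fun (bigD1 (Ordinal kn)) //=.
apply: le_trans (_ : (h (pi *+ 2 * k%:R / n%:R))%:R%:E <= _)%E.
  rewrite lee_fin ler_nat; apply: he => /=.
  rewrite ger0_norm ?subr_ge0 //; apply: le_lt_trans ne.
  rewrite lerBlDl -mulrDl.
  by apply: ltW; move: tk'; rewrite -natr1 mulrDr mulr1.
rewrite indicE mem_set /=; last by rewrite /arc /= in_itv /= kt' tk'.
rewrite mule1 leeDl //; apply: sume_ge0 => i _; exact: scaled_indic_ge0.
Unshelve. all: by end_near. Qed.

End StepFunctions.

(** The integrand lies below the limit inferior of its step functions, Fatou's lemma moves that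
    limit outside the integral, and [circ_inertia] bounds the Riemann sums with [n > 0] by [v n]. *)
Lemma integral_n_neg_le (R : realType) m (D : 'I_m -> 'I_m -> seq int) c :
  (0 < m)%N -> is_diff_matrix D -> self_conjugate c ->
  (\int[@lebesgue_measure R]_(t in `[0%R, (pi *+ 2)%R[)
     (n_neg (laurent_eval D c (expi t)))%:R%:E
   <= (pi *+ 2 * m%:R * (1 - alpha_D R D))%:E)%E.
Proof.
move=> m0 Ddiff csc.
pose h t := n_neg (laurent_eval D c (expi t)).
pose x n : R := (alpha_G D n)%:R / (n * m)%:R.
have mI : measurable (`[0%R, (pi *+ 2)%R[%classic : set R).
  exact: measurable_itv.
have mstep n : measurable_fun `[0%R, (pi *+ 2)%R[%classic (step_fun h n).
  exact: measurable_step_fun.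
apply: (@le_trans _ _ (\int[@lebesgue_measure R]_(t in `[0%R, (pi *+ 2)%R[)
    limn_einf (step_fun h ^~ t))%E).
  apply: ge0_le_integral => //.
  - exact: measurable_n_neg.
  (* The limit inferior is minus the limit superior of the opposites, which is measurable. *)
  - apply: measurableT_comp; first exact: oppe_measurable.
    apply: measurable_fun_limn_esup => n.
    by apply: measurableT_comp; [exact: oppe_measurable|exact: mstep].
  - move=> t /=; rewrite in_itv /= => t2; apply: step_fun_liminf => //.
    exact: n_neg_laurent_lsc.
apply: le_trans (fatou _ _ _ _) _ => //; first by move=> *; exact: step_fun_ge0.
have cx : (x n @[n --> \oo] --> alpha_D R D)%classic by exact: cvg_alpha_G.
pose v n := pi *+ 2 * m%:R * (1 - x n).
have cv : (v n @[n --> \oo] --> pi *+ 2 * m%:R * (1 - alpha_D R D))%classic.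
  by apply: cvgMr; apply: cvgB => //; exact: cvg_cst.
have cve : ((v n)%:E @[n --> \oo] -->
    (pi *+ 2 * m%:R * (1 - alpha_D R D))%:E)%classic.
  by apply: cvg_EFin => //; exact: nearW.
(* Infima over tails are compared termwise with [v]: each is at most the first integral of its
   tail. *)
rewrite limn_einf_lim -(cvg_lim _ cve) //.
apply: lee_lim; [exact: is_cvg_einfs|by apply/cvg_ex; eexists; exact: cve|].
near=> n.
have n0 : (0 < n)%N by near: n; exact: nbhs_infty_gt.
apply: (@le_trans _ _ (\int[@lebesgue_measure R]_(t in `[0%R, (pi *+ 2)%R[)
    step_fun h n t)%E).
  by apply: ereal_inf_lbound; exists n => /=.
rewrite integral_step_fun // lee_fin /v.
have n0R : 0 < n%:R :> R by rewrite ltr0n.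
have m0R : 0 < m%:R :> R by rewrite ltr0n.
have := circ_inertia n Ddiff csc; rewrite -(ler_nat R) natrD natrM => hn.
rewrite -lerBrDl in hn.
apply: le_trans (ler_wpM2r _ hn) _.
  by rewrite divr_ge0 // mulrn_wge0 // pi_ge0.
rewrite /x natrM le_eqVlt; apply/orP; left; apply/eqP; field.
by rewrite !gt_eqF.
Unshelve. all: by end_near. Qed.

(** * Zeros of the determinant, negation of [F], and the two bounds *)

Lemma det_laurent_eval (R : realType) m (D : 'I_m -> 'I_m -> seq int)
    (c : 'I_m -> 'I_m -> int -> R[i]) z : z != 0 ->
  (\det (shifted_poly_mx D c)).[z]
  = (z ^+ shiftN D) ^+ m * \det (laurent_eval D c z).
Proof.
move=> z0; rewrite -detZ -[LHS]/(horner_eval z _) -det_map_mx; congr (\det _).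
apply/matrixP => i j; rewrite !mxE rmorph_sum mulr_sumr /=.
apply: eq_big_seq => d; rewrite mem_undup => dD.
rewrite /horner_eval hornerZ hornerXn mulrCA; congr (_ * _).
(* As [d + shiftN D] is nonnegative, [absz] leaves the exponent unchanged and the common power of
   [z] splits off. *)
rewrite [LHS]exprnP gez0_abs; first by rewrite expfzDr // mulrC.
by have := diff_le_shiftN dD; lia.
Qed.

(** Each such [expi t] is one of the finitely many roots of a nonzero polynomial, and [t] is
    recovered from its real part: by [acos] for [t <= pi], by [2 pi - acos] beyond. *)
Lemma singular_laurent_countable (R : realType) m (D : 'I_m -> 'I_m -> seq int)
    (c : 'I_m -> 'I_m -> int -> R[i]) : non_degenerate D c ->
  countable [set t : R | 0 <= t <= pi *+ 2 /\
                         \det (laurent_eval D c (expi t)) = 0]%classic.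
Proof.
move=> nd; have [rs rsE] := closed_field_poly_normal (\det (shifted_poly_mx D c)).
pose s := [seq acos (complex.Re z) | z <- rs] ++
          [seq pi *+ 2 - acos (complex.Re z) | z <- rs].
apply: (@sub_countable _ _ _ [set` s]%classic); last first.
  exact/finite_set_countable/finite_seq.
apply: subset_card_le => t /= [/andP[t0 t2] dt].
have zr : expi t \in rs.
  have : root (\det (shifted_poly_mx D c)) (expi t).
    by rewrite /root det_laurent_eval ?expi_neq0 // dt mulr0.
  by rewrite rsE rootZ ?lead_coef_eq0 // root_prod_XsubC.
rewrite /s mem_cat; have [tpi|tpi] := leP t pi.
  apply/orP; left; apply/mapP; exists (expi t) => //=.
  by rewrite cosK // in_itv /= t0 tpi.
apply/orP; right; apply/mapP; exists (expi t) => //=.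
rewrite -cosN -cosD2pi cosK ?in_itv /=; first by ring.
by apply/andP; split; lra.
Qed.

Lemma laurent_evalN (R : realType) m (D : 'I_m -> 'I_m -> seq int)
    (c : 'I_m -> 'I_m -> int -> R[i]) z :
  laurent_eval D (fun i j d => - c i j d) z = - laurent_eval D c z.
Proof.
apply/matrixP => i j; rewrite !mxE -sumrN.
by apply: eq_bigr => d _; rewrite mulNr.
Qed.

Lemma n_neg_laurentN (R : realType) m (D : 'I_m -> 'I_m -> seq int)
    (c : 'I_m -> 'I_m -> int -> R[i]) t : is_diff_matrix D -> self_conjugate c ->
  n_neg (laurent_eval D (fun i j d => - c i j d) (expi t))
  = n_pos (laurent_eval D c (expi t)).
Proof.
by move=> Ddiff csc; rewrite laurent_evalN n_negN //;
  exact: laurent_eval_hermitian.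
Qed.

Lemma self_conjugateN (R : realType) m (c : 'I_m -> 'I_m -> int -> R[i]) :
  self_conjugate c -> self_conjugate (fun i j d => - c i j d).
Proof. by move=> csc i j d; rewrite csc rmorphN. Qed.

Lemma n_pos_laurentN (R : realType) m (D : 'I_m -> 'I_m -> seq int)
    (c : 'I_m -> 'I_m -> int -> R[i]) t : is_diff_matrix D -> self_conjugate c ->
  n_pos (laurent_eval D (fun i j d => - c i j d) (expi t))
  = n_neg (laurent_eval D c (expi t)).
Proof.
move=> Ddiff csc.
have h := laurent_eval_hermitian t Ddiff (self_conjugateN csc).
by rewrite -(n_negN h) laurent_evalN opprK.
Qed.

(** Off a null set the numbers of positive and negative eigenvalues add up to [m], so the integral
    of the former is [2 pi m] minus that of the latter, which [integral_n_neg_le] bounds. *)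
Lemma alpha_D_le_rho_plus (R : realType) m (D : 'I_m -> 'I_m -> seq int)
    (c : 'I_m -> 'I_m -> int -> R[i]) :
  is_diff_matrix D -> self_conjugate c -> non_degenerate D c ->
  ((alpha_D R D)%:E <= rho_plus D c)%E.
Proof.
move=> Ddiff csc nd; have [m0|m0] := posnP m.
  (* For [m = 0] division by zero makes both sides 0. *)
  rewrite /rho_plus [X in (2 * pi * X%:R)^-1]m0 mulr0 invr0 mul0e lee_fin.
  rewrite /alpha_D (_ : (fun _ => _) = fun=> 0) ?lim_cst //.
  by apply/funext => n; rewrite [X in (_ * X)%N]m0 muln0 invr0 mulr0.
have m0R : 0 < m%:R :> R by rewrite ltr0n.
have pi20 : 0 < pi *+ 2 :> R by rewrite mulrn_wgt0 ?pi_gt0.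
pose I : set R := `[0%R, (pi *+ 2)%R]%classic.
have mI : measurable I by exact: measurable_itv.
pose np t : \bar R := (n_pos (laurent_eval D c (expi t)))%:R%:E.
pose nn t : \bar R := (n_neg (laurent_eval D c (expi t)))%:R%:E.
have mnn (B : set R) : measurable B -> measurable_fun B nn.
  exact: measurable_n_neg.
have mnp : measurable_fun I np.
  (* Positive eigenvalues of [F] are negative ones of [- F], so measurability carries over. *)
  have := measurable_n_neg Ddiff (self_conjugateN csc) mI.
  apply: eq_measurable_fun => t _.
  by rewrite n_neg_laurentN.
have nn_le : (\int[@lebesgue_measure R]_(t in I) nn t
    <= (pi *+ 2 * m%:R * (1 - alpha_D R D))%:E)%E.
  (* The closed and the half-open interval differ by one point, a null set. *)
  rewrite /I -integral_itv_bndo_bndc; last exact: mnn.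
  exact: integral_n_neg_le.
have sumE : (\int[@lebesgue_measure R]_(t in I) np t +
    \int[@lebesgue_measure R]_(t in I) nn t = (pi *+ 2 * m%:R)%:E)%E.
  rewrite -ge0_integralD //; try by move=> t _; rewrite lee_fin.
  2: exact: mnn.
  transitivity (\int[@lebesgue_measure R]_(t in I) (cst m%:R%:E) t)%E.
    apply: ge0_ae_eq_integral => //.
        - by apply: emeasurable_funD => //; exact: mnn.
    - by move=> t _; rewrite -EFinD lee_fin.
    - by move=> t _; rewrite lee_fin.
    (* The exceptional set: the countably many parameters where the determinant vanishes. *)
    exists [set t : R | 0 <= t <= pi *+ 2 /\
                         \det (laurent_eval D c (expi t)) = 0]%classic.
    have cB := singular_laurent_countable nd.
    split; [exact: countable_measurable|exact: countable_lebesgue_measure0|].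
    move=> t /=; apply: contra_notP => /not_andP nB It.
    rewrite /np /nn -EFinD -natrD n_posDn_neg //.
      exact: laurent_eval_hermitian.
    apply/eqP => dt; case: nB => // nI; apply: nI.
  have lI : lebesgue_measure I = (pi *+ 2)%:E.
    by rewrite /I lebesgue_measure_itv /= lte_fin pi20 -EFinB subr0.
  by rewrite integral_cst // [X in (_ * X)%E]lI -EFinM mulrC.
rewrite /rho_plus.
have -> : 2 * pi = pi *+ 2 :> R by rewrite mulr_natl.
rewrite -/I -[X in (_ * X)%E]/(\int[@lebesgue_measure R]_(t in I) np t)%E.
have nn_fin : (\int[@lebesgue_measure R]_(t in I) nn t)%E \is a fin_num.
  rewrite ge0_fin_numE ?(le_lt_trans nn_le) ?ltry //.
  by apply: integral_ge0 => t _; rewrite lee_fin.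
set b := fine (\int[@lebesgue_measure R]_(t in I) nn t)%E.
have npE : (\int[@lebesgue_measure R]_(t in I) np t
    = (pi *+ 2 * m%:R - b)%:E)%E.
  by rewrite EFinB fineK // -sumE addeK.
have b_le : b <= pi *+ 2 * m%:R * (1 - alpha_D R D) by rewrite -lee_fin fineK.
by rewrite npE -EFinM lee_fin mulrC ler_pdivlMr ?mulr_gt0 //; lra.
Qed.

Unset Implicit Arguments.

Theorem theorem9 (R : realType) (m : nat) (D : 'I_m -> 'I_m -> seq int)
    (c : 'I_m -> 'I_m -> int -> R[i]) :
  is_diff_matrix D ->
  majorized D c ->
  self_conjugate c ->
  non_degenerate D c ->
  ((alpha_D R D)%:E <= Order.min (rho_plus D c) (rho_minus D c))%E.
Proof.
move=> Ddiff _ csc nd; rewrite le_min alpha_D_le_rho_plus //=.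
have -> : rho_minus D c = rho_plus D (fun i j d => - c i j d).
  rewrite /rho_minus /rho_plus; congr (_ * _)%E; apply: eq_integral => t _.
  by rewrite n_pos_laurentN.
apply: alpha_D_le_rho_plus => //; first exact: self_conjugateN.
(* Negating the matrix changes its determinant at most by a sign. *)
rewrite /non_degenerate (_ : shifted_poly_mx _ _ = - shifted_poly_mx D c).
  by rewrite -scaleN1r detZ mulf_neq0 ?expf_neq0 ?oppr_eq0 ?oner_neq0.
apply/matrixP => i j; rewrite !mxE -sumrN.
by apply: eq_bigr => d _; rewrite scaleNr.
Qed.
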